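(* Let $l \ge 1$ and $\kappa \ge 1$ be integers. Consider the big-tasks split-merge system with $l$ workers and $l$ tasks per job, where the task service times $Q_i(n)$, $i\in[1,l]$, $n\ge1$, are iid $\mathrm{Erlang}(\kappa,\mu)$ with $\mu>0$, and the job inter-arrival times are iid exponential with parameter $\lambda>0$. Let $\varrho = \lambda\, \mathsf{E}[Q_i(n)] = \lambda\kappa/\mu$ be the utilization. Then the stability condition $\lambda\,\mathsf{E}[\Delta(n)]<1$ holds if and only if $$\varrho < \frac{\mathsf{E}[Q_i(n)]}{\mathsf{E}[\Delta(n)]} = \frac{\kappa}{\mu\, \mathsf{E}[\Delta(n)]},$$ where $\Delta(n)$ is the service time of job $n$ and $$\mathsf{E}[\Delta(n)] = \int_0^{\infty} \left( 1-\left(1 - e^{-\mu x} \sum_{j=0}^{\kappa-1} \frac{(\mu x)^j}{j!}\right)^{l}\, \right) dx .$$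
   Context: Big-tasks split-merge system: there are $l$ identical workers (servers). Job $n\ge 1$ arrives at time $A(n)$ and consists of exactly $l$ tasks with service times $Q_1(n),\dots,Q_l(n)$. Jobs are served one at a time in order of arrival: job $n$ starts service at time $\max\{A(n),D(n-1)\}$, where $D(n)$ is the departure time of job $n$ and $D(0)=0$; at that instant all $l$ tasks start simultaneously, one on each worker, and the job departs when all its tasks have finished. Hence the job service time is $\Delta(n) = \max_{i\in[1,l]} Q_i(n)$. $\mathrm{Erlang}(\kappa,\mu)$ denotes the distribution of the sum of $\kappa$ iid exponential random variables with parameter $\mu$ (mean $\kappa/\mu$). Stability: the system is considered stable when the expected inter-arrival time exceeds the expected job service time, i.e. $1/\lambda > \mathsf{E}[\Delta(n)]$. *)

(* Defs.v *)
From HB Require Import structures.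
From mathcomp Require Import all_boot all_order all_algebra.
From mathcomp Require Import all_classical all_reals all_analysis measurable_realfun.

Set Implicit Arguments.
Unset Strict Implicit.
Unset Printing Implicit Defensive.
Import Order.TTheory GRing.Theory Num.Def Num.Theory.
Import numFieldNormedType.Exports.
Local Open Scope classical_set_scope.
Local Open Scope ring_scope.

(* Mutual independence of the subfamily of [X] indexed by [J]: the product
   rule over every finite set of indices (a duplicate-free sequence) in [J]. *)
Definition mutually_independent {d : measure_display} {T : measurableType d}
    {R : realType} (P : probability T R) (I : eqType) (J : set I)
    (X : I -> {RV P >-> R}) : Prop :=
  forall (s : seq I) (A : I -> set R),
    uniq s -> (forall i, i \in s -> J i) ->
    (forall i, i \in s -> measurable (A i)) ->
    P (\bigcap_(i in [set` s]) (X i @^-1` A i)) =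
    (\prod_(i <- s) P (X i @^-1` A i))%E.

Definition is_exponential {d : measure_display} {T : measurableType d}
    {R : realType} (P : probability T R) (rate : R) (X : {RV P >-> R}) : Prop :=
  forall A : set R, measurable A -> distribution P X A = exponential_prob rate A.

(* [X] has the law of the sum of [kappa] iid exponential variables; these may
   live on any probability space, not only on that of [X]. *)
Definition is_erlang {d : measure_display} {T : measurableType d}
    {R : realType} (P : probability T R) (kappa : nat) (rate : R)
    (X : {RV P >-> R}) : Prop :=
  exists (d' : measure_display) (T' : measurableType d')
    (P' : probability T' R) (Y : 'I_kappa -> {RV P' >-> R}),
    [/\ mutually_independent setT Y,
        forall k, is_exponential rate (Y k) &
        forall A : set R, measurable A ->
          distribution P X A = P' [set w | A (\sum_(k < kappa) Y k w)]].

(* Jobs are numbered from 1: the values of both fields at index 0 are junk. *)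
Record split_merge {d : measure_display} {T : measurableType d}
    {R : realType} (P : probability T R) (l : nat) := SplitMerge {
  arrival : nat -> {RV P >-> R} ;
  task : nat -> 'I_l -> {RV P >-> R} }.

Section SplitMergeDynamics.
Context {d : measure_display} {T : measurableType d} {R : realType}
  {P : probability T R} {l : nat}.
Variable S : split_merge P l.

(* The time between the arrivals of jobs [n] and [n.+1], for [0 < n]. *)
Definition interarrival (n : nat) : {RV P >-> R} :=
  (arrival S n.+1 : {mfun T >-> R}) - arrival S n.

(* The departure of a job that starts at time [s] is the latest of the finish
   times [s + task S n i]; seeding this maximum with [s] is harmless because
   service times are almost surely nonnegative. *)
Fixpoint departure (n : nat) (w : T) : R :=
  if n is m.+1 then
    let s := maxr (arrival S n w) (departure m w) in
    \big[maxr/s]_(i < l) (s + task S n i w)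
  else 0.

Definition start (n : nat) (w : T) : R :=
  maxr (arrival S n w) (departure n.-1 w).

Definition job_service_time (n : nat) (w : T) : R :=
  departure n w - start n w.

Lemma job_service_timeE (n : nat) (w : T) : (0 < n)%N ->
  job_service_time n w = \big[maxr/0]_(i < l) task S n i w.
Proof.
case: n => // n _; rewrite /job_service_time /start /=.
set s := maxr _ _; apply/eqP; rewrite subr_eq addrC; apply/eqP.
by elim/big_rec2: _ => [|i x y _ ->]; rewrite ?addr0// addr_maxr.
Qed.

Definition stable : Prop :=
  forall n : nat, (0 < n)%N ->
    ('E_P[job_service_time n] < 'E_P[interarrival n])%E.

End SplitMergeDynamics.

(* Main.v *)
From HB Require Import structures.
Require Import Defs.
From mathcomp Require Import all_boot all_order all_algebra.
From mathcomp Require Import all_classical all_reals all_analysis.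
From mathcomp Require Import measurable_realfun ring lra.
Set Implicit Arguments.
Unset Strict Implicit.
Unset Printing Implicit Defensive.
Import Order.TTheory GRing.Theory Num.Theory.
Import numFieldNormedType.Exports.
Local Open Scope classical_set_scope.
Local Open Scope ring_scope.

(** The job service time is the maximum of [l] independent Erlang variables, so
    its distribution function is the [l]-th power of the Erlang one and the tail
    formula [E X = int_0^oo P (X > x) dx] yields the stated integral.

    The Erlang tail [e^(-mu x) * sum_(j < kappa) (mu x)^j / j!] is obtained by
    adding the exponentials one at a time: the joint law of a new exponential
    and of the partial sum is a product measure, and the convolution
    [int_0^x mu e^(-mu y) G_k (x - y) dy + e^(-mu x)] of the tail [G_k] with the
    exponential density is computed by the fundamental theorem of calculus.

    All jobs have the same mean service time [EDelta] and all interarrival times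
    have mean [1 / lambda], so stability is [EDelta < 1 / lambda]; dividing by
    [EDelta >= EQ > 0] gives the bound on the utilization. *)

(** * Erlang tails and their convolution with the exponential density *)

Definition erlang_tail {R : realType} (kappa : nat) (rate x : R) : R :=
  expR (- (rate * x)) * \sum_(0 <= j < kappa) (rate * x) ^+ j / j`!%:R.

(* Below [0] the expression [erlang_tail] is no longer the probability of
   exceeding [x], which is then [1]. *)
Definition erlang_ccdf {R : realType} (kappa : nat) (rate x : R) : R :=
  if x < 0 then 1 else erlang_tail kappa rate x.

Lemma erlang_tail1 {R : realType} (rate x : R) :
  erlang_tail 1 rate x = expR (- (rate * x)).
Proof. by rewrite /erlang_tail big_nat1 expr0 fact0 divr1 mulr1. Qed.

Section erlang_tail.
Context {R : realType}.
Variable rate : R.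
Hypothesis rate_gt0 : 0 < rate.
Local Notation mu := (@lebesgue_measure R).

(** Normalized to vanish at [y = x]; at [y = 0] it is minus the terms of index 1 to [k] of the
    Erlang sum at [x]. *)
Let primitive_erlang_sum (k : nat) (x y : R) : R :=
  - \sum_(0 <= j < k) (rate * (x - y)) ^+ j.+1 / j.+1`!%:R.

Let is_derive_primitive_erlang_sum k (x y : R) :
  is_derive y 1 (primitive_erlang_sum k x)
    (rate * \sum_(0 <= j < k) (rate * (x - y)) ^+ j / j`!%:R).
Proof.
elim: k => [|k IH].
  rewrite big_geq// mulr0 (_ : primitive_erlang_sum 0 x = cst 0).
    exact: is_derive_cst.
  by apply/funext => z; rewrite /primitive_erlang_sum big_geq// oppr0.
rewrite big_nat_recr//= mulrDr.
have -> : primitive_erlang_sum k.+1 x = primitive_erlang_sum k x +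
    (- k.+1`!%:R^-1) *: (rate *: (cst x - id)) ^+ k.+1.
  apply/funext => z; rewrite /primitive_erlang_sum big_nat_recr//= opprD.
  by congr (_ + _); rewrite mulrC -mulNr; congr (_ * _); rewrite exprfctE.
apply: is_deriveD.
apply: is_derive_eq.
have k0 : k.+1%:R != 0 :> R by rewrite pnatr_eq0.
have kf0 : k`!%:R != 0 :> R by rewrite pnatr_eq0 -lt0n fact_gt0.
rewrite /GRing.scale/= factS natrM.
rewrite (_ : _ *: _ = rate * (x - y))//.
field.
by rewrite kf0 nat1r.
Qed.

Let continuous_erlang_sum k (x : R) :
  continuous (fun y : R => \sum_(0 <= j < k) (rate * (x - y)) ^+ j / j`!%:R).
Proof.
elim: k => [|k IH] y.
  under eq_fun do rewrite big_geq//.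
  exact: cvg_cst.
under eq_fun do rewrite big_nat_recr//=.
apply: cvgD; first exact: IH.
apply: cvgMl.
apply: (@continuous_comp _ _ _ (fun y => rate * (x - y)) (fun z => z ^+ k)).
  by apply: cvgMr; apply: cvgB; [exact: cvg_cst|exact: cvg_id].
exact: exprn_continuous.
Qed.

(** The exponents [- rate * y] and [- rate * (x - y)] add up to [- rate * x], so the exponential
    factor leaves the integral and a polynomial in [y] remains. Integration raises every degree by
    one, so the term of index 0 is absent; this is the subtracted exponential. *)
Lemma integral_exponential_erlang_tail k (x : R) : 0 < x ->
  (\int[mu]_(y in `[0%R, x])
     (exponential_pdf rate y * erlang_tail k rate (x - y))%:E =
   (erlang_tail k.+1 rate x - expR (- (rate * x)))%:E)%E.
Proof.
move=> x0.
pose f (y : R) := expR (- (rate * x)) *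
  (rate * \sum_(0 <= j < k) (rate * (x - y)) ^+ j / j`!%:R).
pose F (y : R) : R := expR (- (rate * x)) * primitive_erlang_sum k x y.
have dF (y : R) : is_derive y 1 F (f y).
  have -> : F = expR (- (rate * x)) *: primitive_erlang_sum k x by [].
  exact: is_deriveZ.
transitivity (\int[mu]_(y in `[0%R, x]) (f y)%:E)%E.
  apply: eq_integral => y; rewrite inE/= in_itv/= => /andP[y0 yx].
  rewrite exponential_pdfE// /f /erlang_tail; congr EFin.
  have -> : - (rate * x) = - rate * y + - (rate * (x - y)) by ring.
  by rewrite expRD; ring.
have cf : continuous f.
  by move=> y; apply: cvgMr; apply: cvgMr; exact: continuous_erlang_sum.
have cF : continuous F.
  by move=> y; apply/differentiable_continuous/derivable1_diffP.
rewrite (@continuous_FTC2 _ f F)//.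
- have -> : F x = 0.
    rewrite /F /primitive_erlang_sum subrr big1 ?oppr0 ?mulr0// => j _.
    by rewrite expr0n mul0r.
  rewrite -EFinB sub0r /F /primitive_erlang_sum subr0; congr EFin.
  rewrite mulrN opprK /erlang_tail [in RHS]big_nat_recl//= expr0 fact0 divr1.
  by rewrite mulrDr mulr1 addrAC subrr add0r.
- exact: continuous_subspaceT.
- split; first by move=> y _; have [] := dF y.
  + by apply: cvg_at_right_filter; exact: cF.
  + by apply: cvg_at_left_filter; exact: cF.
- by move=> y _; rewrite derive1E derive_val.
Qed.

Lemma exponential_prob_itvoy (x : R) :
  exponential_prob rate `]x, +oo[ = (erlang_ccdf 1 rate x)%:E.
Proof.
have mpdf D : measurable_fun D (EFin \o exponential_pdf rate).
  by apply/measurable_funTS/measurable_EFinP; exact: measurable_exponential_pdf.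
have ccdf_ge0 (y : R) : 0 <= y ->
    exponential_prob rate `]y, +oo[ = (expR (- (rate * y)))%:E.
  move=> y0; rewrite /exponential_prob integral_itv_obnd_cbnd//.
  rewrite (@ge0_continuous_FTC2y _ _ (fun x => - (expR (- rate * x))) _ 0)//.
  - by rewrite sub0e -EFinN opprK mulNr.
  - by move=> z _; apply: exponential_pdf_ge0; exact: ltW.
  - apply: (@continuous_subspaceW R^o _ _ [set` `[0%R, +oo[%R]).
      by apply: subset_itvr; rewrite bnd_simp.
    exact: within_continuous_exponential_pdf.
  - rewrite -oppr0; apply: cvgN.
    rewrite (_ : (fun x => expR (- rate * x)) =
                 (fun z => expR (- z)) \o (fun z => rate * z)); last first.
      by apply: eq_fun => z; rewrite mulNr.
    apply: (@cvg_comp _ _ _ _ _ _ (pinfty_nbhs R)); last exact: cvgr_expR.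
    exact: gt0_cvgMry.
  - apply: cvgN; apply/cvg_at_right_filter.
    apply: (@continuous_comp _ _ _ (fun z => - rate * z) expR).
      by apply: cvgMr; exact: cvg_id.
    exact: continuous_expR.
  - move=> z; rewrite in_itv/= andbT => yz.
    apply: derive1_exponential_pdf; rewrite in_itv/= andbT.
    exact: le_lt_trans yz.
rewrite /erlang_ccdf; case: ltP => x0; last first.
  by rewrite ccdf_ge0// erlang_tail1.
(* For [x < 0] the mass lies between that of []0, +oo[] and the total mass, both equal to 1. *)
apply/eqP; rewrite eq_le; apply/andP; split.
  rewrite -(integral_exponential_pdf rate_gt0).
  apply: ge0_subset_integral => //; first exact: mpdf.
  by move=> y _; rewrite lee_fin exponential_pdf_ge0// ltW.
rewrite -[leLHS](_ : exponential_prob rate `]0, +oo[ = 1%E); last first.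
  by rewrite ccdf_ge0// mulr0 oppr0 expR0.
apply: ge0_subset_integral => //; first exact: mpdf.
  by move=> y _; rewrite lee_fin exponential_pdf_ge0// ltW.
by apply: subset_itvr; rewrite bnd_simp ltW.
Qed.
End erlang_tail.

(** * Independence of a partial sum from the remaining variables *)

Section independence.
Context d (T : measurableType d) (R : realType) (P : probability T R).

(* The event [C] is carried along so that independence from the remaining
   variables survives the induction in [independent_sum]. *)
Lemma pair_law (X Z : {RV P >-> R}) (C : set T) : measurable C ->
  (forall A B, measurable A -> measurable B ->
    P (X @^-1` A `&` Z @^-1` B `&` C) =
    (P (X @^-1` A) * P (Z @^-1` B) * P C)%E) ->
  forall E : set (R * R), measurable E ->
    P ((fun w => (X w, Z w)) @^-1` E `&` C) =
    ((distribution P X \x distribution P Z) E * P C)%E.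
Proof.
move=> mC indep E mE.
have PC_ge0 : 0 <= fine (P C) by rewrite fine_ge0.
(* [P C] is a finite scalar multiplying the second factor, so that uniqueness of
   the product measure applies to the restriction of [P] to [C]. *)
pose c : {nonneg R} := NngNum PC_ge0.
have cE : c%:num%:E = P C by rewrite /= fineK// fin_num_measure.
have mV : measurable_fun [set: T] (fun w => (X w, Z w)).
  exact: measurable_fun_pair.
pose V : {mfun T >-> (R * R)%type} := HB.pack (fun w => (X w, Z w))
  (isMeasurableFun.Build _ _ _ _ _ mV).
rewrite (_ : P _ = pushforward (mrestr P mC) V E)//.
rewrite -(@product_measure_unique _ _ _ _ _ (distribution P X)
  (mscale c (distribution P Z)))//.
  rewrite /product_measure1 muleC -cE.
  rewrite -ge0_integralZl//.
  exact: measurable_fun_xsection.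
move=> A B mA mB.
transitivity (P (X @^-1` A `&` Z @^-1` B `&` C)) => //.
by rewrite indep// -muleA [X in (_ * X)%E]muleC -cE.
Qed.

(** Summing among measurable functions keeps measurability attached, so that a partial sum is again
    a random variable. *)
Definition mfun_sum (I : Type) (X : I -> {mfun T >-> R}) (s : seq I) :
  {mfun T >-> R} := \sum_(i <- s) X i.

Lemma mfun_sumE (I : Type) (X : I -> {mfun T >-> R}) (s : seq I) (w : T) :
  mfun_sum X s w = \sum_(i <- s) X i w.
Proof. by rewrite /mfun_sum; elim/big_rec2: _ => // i x f _ <-. Qed.

Variables (I : eqType) (J : set I) (X : I -> {RV P >-> R}).
Hypothesis indepX : mutually_independent J X.

Let measurable_event (t : seq I) (B : I -> set R) :
  (forall i, i \in t -> measurable (B i)) ->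
  measurable (\bigcap_(i in [set` t]) (X i @^-1` B i)).
Proof.
move=> mB; apply: fin_bigcap_measurable; first exact: finite_seq.
by move=> i /= it; apply: measurable_funPTI => //; exact: mB.
Qed.

(** Induction on [s] with [t] arbitrary: a variable taken out of the sum joins the event indexed by
    [t]. This gives the product rule on rectangles, which [pair_law] extends to the set of pairs
    whose sum lies in [A]. *)
Lemma independent_sum (s t : seq I) (A : set R) (B : I -> set R) :
  uniq (s ++ t) -> (forall i, i \in s ++ t -> J i) ->
  measurable A -> (forall i, i \in t -> measurable (B i)) ->
  P (mfun_sum X s @^-1` A `&`
     \bigcap_(i in [set` t]) (X i @^-1` B i)) =
  (P (mfun_sum X s @^-1` A) *
   P (\bigcap_(i in [set` t]) (X i @^-1` B i)))%E.
Proof.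
elim: s t A B => [|j s IH] t A B.
  move=> _ _ mA mB; rewrite /mfun_sum big_nil.
  have [A0|A0] := pselect (A 0).
    rewrite (_ : _ @^-1` A = setT); last by apply/seteqP; split.
    by rewrite setTI probability_setT mul1e.
  rewrite (_ : _ @^-1` A = set0); last by apply/seteqP; split.
  by rewrite set0I measure0 mul0e.
have rect t' B' : uniq ((j :: s) ++ t') ->
    (forall i, i \in (j :: s) ++ t' -> J i) ->
    (forall i, i \in t' -> measurable (B' i)) ->
    forall A0 B0, measurable A0 -> measurable B0 ->
    P (X j @^-1` A0 `&`
       mfun_sum X s @^-1` B0 `&`
       \bigcap_(i in [set` t']) (X i @^-1` B' i)) =
    (P (X j @^-1` A0) *
     P (mfun_sum X s @^-1` B0) *
     P (\bigcap_(i in [set` t']) (X i @^-1` B' i)))%E.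
  move=> ust Jst mB' A0 B0 mA0 mB0.
  (* The event on [X j] is merged into the family, so that the induction hypothesis applies with
     [j :: t']. *)
  pose B'' i := if i == j then A0 else B' i.
  have jt : j \notin t'.
    by move: ust; rewrite /= mem_cat negb_or => /andP[/andP[]].
  have mB'' i : i \in j :: t' -> measurable (B'' i).
    by rewrite inE /B''; case: eqP => //= _; exact: mB'.
  have Jjt i : i \in j :: t' -> J i.
    move=> ijt; apply: Jst; rewrite mem_cat !inE.
    by move: ijt; rewrite inE => /orP[->//|->]; rewrite orbT.
  have ut : uniq t' by move: ust; rewrite cat_uniq => /and3P[].
  have B''E : \bigcap_(i in [set` t']) (X i @^-1` B'' i) =
              \bigcap_(i in [set` t']) (X i @^-1` B' i).
    apply: eq_bigcapr => i /= it; rewrite /B''; case: eqP => // ij.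
    by move: jt; rewrite -ij it.
  have capE : \bigcap_(i in [set` j :: t']) (X i @^-1` B'' i) =
      X j @^-1` A0 `&` \bigcap_(i in [set` t']) (X i @^-1` B' i).
    have -> : [set` j :: t'] = j |` [set` t'].
      apply/seteqP; split=> i /=; rewrite inE.
        by case/predU1P; [left|right].
      by case=> [->|->]; rewrite ?eqxx ?orbT.
    by rewrite bigcap_setU1 B''E /B'' eqxx.
  rewrite (setIC (X j @^-1` A0)) -setIA -capE IH//; last 2 first.
    by rewrite -cat1s uniq_catCA.
    by move=> i ist; apply: Jst; move: ist; rewrite !mem_cat !inE orbCA orbA.
  rewrite indepX//=; last by rewrite jt.
  rewrite big_cons {1}/B'' eqxx -indepX//; last 2 first.
    by move=> i it; apply: Jjt; rewrite inE it orbT.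
    by move=> i it; apply: mB''; rewrite inE it orbT.
  by rewrite B''E muleCA muleA.
move=> ust Jst mA mB.
pose E := [set p : R * R | A (p.1 + p.2)].
have mE : measurable E.
  rewrite -[E]setTI.
  by apply: (measurable_funD measurable_fst measurable_snd).
pose V w := (X j w, mfun_sum X s w).
rewrite /mfun_sum big_cons (_ : _ @^-1` A = V @^-1` E)//.
rewrite pair_law//; last 2 first.
- exact: measurable_event.
- by move=> *; exact: rect.
congr (_ * _)%E.
(* A second use of [pair_law], now with the whole space as the event, turns the product measure of
   [E] back into the probability that the longer sum lies in [A]. *)
rewrite -[in RHS](setIT (V @^-1` E)) pair_law//; last first.
  move=> A0 B0 mA0 mB0.
  have := rect [::] B _ _ _ A0 B0 mA0 mB0.
  rewrite cats0 classical_sets.set_nil bigcap_set0; apply => //.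
  - by move: ust; rewrite cat_uniq => /andP[].
  - by move=> i ijs; apply: Jst; rewrite mem_cat ijs.
by rewrite probability_setT mule1.
Qed.

End independence.

(** * Convolution recursion for the Erlang tail on the whole line *)

Section erlang_law.
Context {R : realType}.
Variable rate : R.
Hypothesis rate_gt0 : 0 < rate.
Local Notation mu := (@lebesgue_measure R).

Let continuous_erlang_tail k : continuous (erlang_tail k rate : R -> R).
Proof.
move=> x; apply: cvgM.
  apply: (@continuous_comp _ _ _ (fun y => - (rate * y)) expR).
    by apply: cvgN; apply: cvgMr; exact: cvg_id.
  exact: continuous_expR.
elim: k x => [|k IH] x.
  under eq_fun do rewrite big_geq//.
  by rewrite big_geq//; exact: cvg_cst.
under eq_fun do rewrite big_nat_recr//=.
rewrite big_nat_recr//=.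
apply: cvgD; first exact: IH.
apply: cvgMl.
apply: (@continuous_comp _ _ _ (fun y => rate * y) (fun z => z ^+ k)).
  by apply: cvgMr; exact: cvg_id.
exact: exprn_continuous.
Qed.

Lemma measurable_erlang_ccdf k : measurable_fun [set: R] (erlang_ccdf k rate).
Proof.
apply: measurable_fun_ifT => //.
  exact: measurable_fun_ltr.
by apply: continuous_measurable_fun; exact: continuous_erlang_tail.
Qed.

Lemma erlang_ccdf_ge0 k x : 0 <= erlang_ccdf k rate x.
Proof.
rewrite /erlang_ccdf; case: ltP => // x0.
rewrite mulr_ge0 ?expR_ge0// sumr_ge0// => j _.
by rewrite divr_ge0// exprn_ge0// mulr_ge0// ltW.
Qed.

(** For [0 <= x] the integral splits at [y = x]. Beyond [x] the Erlang factor is 1, and the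
    remaining exponential mass [expR (- (rate * x))] is exactly what
    [integral_exponential_erlang_tail] subtracts. For [x < 0] the Erlang factor is 1 wherever the
    density is nonzero. *)
Lemma erlang_ccdf_conv k (x : R) :
  (\int[mu]_y (exponential_pdf rate y * erlang_ccdf k rate (x - y))%:E =
   (erlang_ccdf k.+1 rate x)%:E)%E.
Proof.
have [x0|x0] := ltP x 0.
  rewrite {2}/erlang_ccdf x0 -(integral_exponential_pdf rate_gt0).
  apply: eq_integral => y _; congr EFin.
  have [y0|y0] := ltP y 0; first by rewrite lt0_exponential_pdf// mul0r.
  by rewrite /erlang_ccdf ifT ?mulr1//; lra.
have mf : measurable_fun [set: R] (fun y =>
    (exponential_pdf rate y * erlang_ccdf k rate (x - y))%:E).
  apply/measurable_EFinP; apply: measurable_funM.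
    exact: measurable_exponential_pdf.
  apply: (measurableT_comp (measurable_erlang_ccdf k)).
  exact: measurable_funB.
rewrite -(setUv `]-oo, x]%classic) ge0_integral_setU//=; last 4 first.
- exact: measurableC.
- by rewrite setUv.
- move=> y _; rewrite lee_fin mulr_ge0 ?erlang_ccdf_ge0//.
  by rewrite exponential_pdf_ge0// ltW.
- exact/disj_setPCl.
rewrite setCitvl.
rewrite [X in (_ + X)%E](_ : _ = exponential_prob rate `]x, +oo[); last first.
  apply: eq_integral => y; rewrite inE/= in_itv/= andbT => xy; congr EFin.
  by rewrite /erlang_ccdf ifT ?mulr1//; lra.
rewrite exponential_prob_itvoy//.
rewrite (_ : integral _ _ _ = \int[mu]_(y in `[0%R, x])
    (exponential_pdf rate y * erlang_tail k rate (x - y))%:E)%E; last first.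
  rewrite [LHS]integral_mkcond [RHS]integral_mkcond.
  apply: eq_integral => y _; rewrite !patchE !mem_setE !in_itv/=.
  have [y0|y0]/= := ltP y 0; first
    by rewrite lt0_exponential_pdf// mul0r if_same.
  case: leP => // yx; rewrite /erlang_ccdf ifF//.
  by apply/negbTE; rewrite -leNgt subr_ge0.
have E1 : erlang_ccdf 1 rate x = expR (- (rate * x)).
  by rewrite /erlang_ccdf ltNge x0 erlang_tail1.
rewrite E1 /erlang_ccdf ltNge x0/=.
(* At [x = 0] the integral runs over a single point and vanishes, and only the term of index 0
   survives on the right. *)
move: x0; rewrite le_eqVlt => /predU1P[<-|x0].
  rewrite set_itv1 integral_set1 add0e mulr0 oppr0 expR0 /erlang_tail.
  rewrite big_nat_recl//= big1 ?addr0; last first.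
    by move=> j _; rewrite mulr0 expr0n mul0r.
  by rewrite mulr0 oppr0 expR0 expr0 fact0 divr1 mulr1.
by rewrite integral_exponential_erlang_tail// -EFinD subrK.
Qed.

End erlang_law.

(** * Law of a sum of independent exponentials *)

Section sum_of_exponentials.
Context d (T : measurableType d) (R : realType) (P : probability T R).
Variable rate : R.
Hypothesis rate_gt0 : 0 < rate.
Local Notation mu := (@lebesgue_measure R).
Variables (I : eqType) (J : set I) (X : I -> {RV P >-> R}).
Hypothesis indepX : mutually_independent J X.

Lemma ccdf_sum_exponential (s : seq I) : uniq s ->
  (forall i, i \in s -> J i) ->
  (forall i, i \in s -> is_exponential rate (X i)) ->
  forall x, ccdf (mfun_sum X s : {RV P >-> R}) x =
            (erlang_ccdf (size s) rate x)%:E.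
Proof.
elim: s => [|j s IH] us Js expX x.
  (* The empty sum is the constant 0, and [erlang_ccdf 0] is the tail of the point mass at 0,
     because [erlang_tail 0] vanishes. *)
  rewrite /ccdf /distribution /pushforward /mfun_sum big_nil /erlang_ccdf.
  case: ltP => x0.
    rewrite (_ : _ @^-1` _ = setT) ?probability_setT//.
    by apply/seteqP; split=> // w _; rewrite /= in_itv/= x0.
  rewrite (_ : _ @^-1` _ = set0).
    by rewrite measure0 /erlang_tail big_geq// mulr0.
  by apply/seteqP; split=> // w; rewrite /= in_itv/= andbT ltNge x0.
pose S : {RV P >-> R} := mfun_sum X s.
have us' : uniq s by case/andP: us.
have Sccdf y : ccdf S y = (erlang_ccdf (size s) rate y)%:E.
  by apply: IH => // i si; [apply: Js|apply: expX]; rewrite inE si orbT.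
have jexp : is_exponential rate (X j) by apply: expX; rewrite mem_head.
pose E := [set p : R * R | x < p.1 + p.2].
have mE : measurable E.
  have := measurable_funD measurable_fst measurable_snd
    measurableT (measurable_itv `]x, +oo[) : measurable (_ : set (R * R)).
  by rewrite setTI; congr measurable; apply/seteqP; split=> p/=;
     rewrite in_itv/= andbT.
have -> : ccdf (mfun_sum X (j :: s) : {RV P >-> R}) x =
          (distribution P (X j) \x distribution P S)%E E.
  transitivity (P ((fun w => (X j w, S w)) @^-1` E `&` setT)).
    rewrite setIT /ccdf /distribution /pushforward /mfun_sum big_cons.
    congr (P _); apply/seteqP; split=> w /=; by rewrite in_itv/= andbT.
  rewrite pair_law//; first by rewrite probability_setT mule1.
  move=> A B mA mB; rewrite setIT probability_setT mule1 setIC.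
  (* Written as an intersection over [[:: j]], the event on [X j] fits [independent_sum]. *)
  have -> : X j @^-1` A = \bigcap_(i in [set` [:: j]]) (X i @^-1` A).
    by rewrite set_cons1 bigcap_set1.
  rewrite (independent_sum indepX)//; first by rewrite muleC.
    by rewrite -cat1s uniq_catC in us.
  by move=> i; rewrite mem_cat mem_seq1 orbC => ij; apply: Js; rewrite inE.
(* Integrating over the exponential variable first turns its law into its
   density; Tonelli then puts the law of the partial sum inside. *)
transitivity ((distribution P (X j) \x^ distribution P S)%E E).
  apply: (@product_measure_unique _ _ _ _ _ _ _
    (distribution P (X j) \x^ distribution P S)%E) => // A B mA mB.
  exact: product_measure2E.
pose f (p : R * R) := (exponential_pdf rate p.1 * \1_E p)%:E.
have mf : measurable_fun [set: R * R] f.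
  apply/measurable_EFinP; apply: measurable_funM => //.
  exact: (measurableT_comp (measurable_exponential_pdf rate) measurable_fst).
have f0 p : (0 <= f p)%E.
  by rewrite lee_fin mulr_ge0// exponential_pdf_ge0// ltW.
transitivity (\int[distribution P S]_y \int[mu]_z f (z, y))%E.
  rewrite /product_measure2; apply: eq_integral => y _ /=.
  rewrite [LHS]jexp; last exact: measurable_ysection.
  rewrite /exponential_prob integral_mkcond; apply: eq_integral => z _.
  rewrite patchE mem_ysection /f /= indicE.
  by case: (_ \in _); rewrite ?mulr1 ?mulr0.
rewrite -fubini_tonelli// -erlang_ccdf_conv//.
apply: eq_integral => y _; rewrite EFinM -Sccdf /f/=.
under eq_integral do rewrite EFinM.
rewrite ge0_integralZl_EFin//; last 2 first.
- exact/measurable_EFinP/measurableT_comp.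
- by rewrite exponential_pdf_ge0// ltW.
congr (_ * _)%E.
(* For fixed [y] the section of [E] is the half-line above [x - y], so the inner integral is the
   tail of [S] there. *)
rewrite (eq_integral (fun z => (\1_(xsection E y) z)%:E)); last first.
  by move=> z _; rewrite !indicE mem_xsection.
rewrite integral_indic//; last exact: measurable_xsection.
rewrite setIT /ccdf; congr (distribution P S _).
apply/seteqP; split=> z; rewrite /xsection /= inE in_itv/= andbT.
  by rewrite /E/=; lra.
by rewrite /E/=; lra.
Qed.

End sum_of_exponentials.

(** * Expectation as the integral of the tail *)

Section expectation_ccdf.
Context d (T : measurableType d) (R : realType) (P : probability T R).
Local Notation mu := (@lebesgue_measure R).

Section ae_nonnegative.
Variable X : {RV P >-> R}.
(* Almost sure nonnegativity, phrased so that it depends only on the law. *)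
Hypothesis X_ge0 : forall x, x < 0 -> ccdf X x = 1%E.

(** The event that [X] is negative is covered by countably many events bounding [X] above by
    [- n.+1%:R^-1], each null by the hypothesis on the tail. *)
Let ae_ge0 : {ae P, forall w, 0 <= X w}.
Proof.
pose F (n : nat) := X @^-1` `]-oo, (- n.+1%:R^-1)%R].
have : P.-negligible (\bigcup_n F n).
  apply: negligible_bigcup => n; apply/negligibleP.
    exact: measurable_funPTI.
  have n0 : - n.+1%:R^-1 < 0 :> R by rewrite oppr_lt0 invr_gt0 ltr0n.
  by rewrite -[LHS]/(cdf X _) cdf_1_ccdf X_ge0// subee.
apply: negligibleS => w /= /negP; rewrite -ltNge => /ltr_add_invr[n Xn].
by exists n => //=; rewrite /F/= in_itv/= -subr_le0 opprK ltW.
Qed.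

Let ae_funrpos : ae_eq P setT (EFin \o X) (EFin \o X^\+).
Proof.
by apply: filterS ae_ge0 => w Xw _ /=; rewrite /funrpos max_l.
Qed.

(** The tail formula for pointwise nonnegative variables is applied to the positive part of [X],
    which equals [X] almost surely and has the same tail at every [r >= 0]. *)
Lemma ae_ge0_expectation_ccdf :
  ('E_P[X] = \int[mu]_(r in `[0%R, +oo[) ccdf X r)%E.
Proof.
transitivity ('E_P[X^\+])%E.
  rewrite unlock; apply: ae_eq_integral => //.
    exact/measurable_EFinP.
  exact/measurable_EFinP/measurable_funrpos.
rewrite ge0_expectation_ccdf; last by move=> w; exact: funrpos_ge0.
apply: eq_integral => r; rewrite inE/= in_itv/= andbT => r0.
rewrite /ccdf /distribution /pushforward; congr (P _).
apply/seteqP; split=> w /=; rewrite !in_itv/= !andbT /funrpos lt_max.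
  by case/orP => //; rewrite ltNge r0.
by move=> ->.
Qed.

Lemma ae_ge0_integrable : ('E_P[X] < +oo)%E -> P.-integrable setT (EFin \o X).
Proof.
move=> Xoo; apply/integrableP; split; first exact/measurable_EFinP.
rewrite (le_lt_trans _ Xoo)// unlock le_eqVlt; apply/orP; left; apply/eqP.
apply: ae_eq_integral => //.
- by apply: measurableT_comp => //; exact/measurable_EFinP.
- exact/measurable_EFinP.
- by apply: filterS ae_ge0 => w Xw _ /=; rewrite ger0_norm.
Qed.

End ae_nonnegative.
End expectation_ccdf.

(** * Tails and means of exponentials and of their sums *)

Section laws.
Context d (T : measurableType d) (R : realType) (P : probability T R).
Variable rate : R.
Hypothesis rate_gt0 : 0 < rate.
Local Notation mu := (@lebesgue_measure R).

Lemma ccdf_exponential (X : {RV P >-> R}) (x : R) :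
  is_exponential rate X -> ccdf X x = (erlang_ccdf 1 rate x)%:E.
Proof. by move=> expX; rewrite /ccdf expX// exponential_prob_itvoy. Qed.

Let erlang_ccdf_lt0 k (x : R) : x < 0 -> (erlang_ccdf k rate x)%:E = 1%E.
Proof. by move=> x0; rewrite /erlang_ccdf x0. Qed.

(** On the nonnegative half-line the tail is [rate^-1] times the density, and the density has total
    mass 1 there. *)
Lemma expectation_exponential (X : {RV P >-> R}) :
  is_exponential rate X -> 'E_P[X]%E = (rate^-1)%:E.
Proof.
move=> expX; rewrite ae_ge0_expectation_ccdf; last first.
  by move=> x x0; rewrite ccdf_exponential// erlang_ccdf_lt0.
have mpdf D : measurable_fun D (EFin \o exponential_pdf rate).
  by apply/measurable_funTS/measurable_EFinP; exact: measurable_exponential_pdf.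
transitivity (\int[mu]_(x in `[0%R, +oo[)
    ((rate^-1)%:E * (exponential_pdf rate x)%:E))%E.
  apply: eq_integral => x; rewrite inE/= in_itv/= andbT => x0.
  rewrite ccdf_exponential// exponential_pdfE// -EFinM mulKf ?gt_eqF//.
  rewrite /erlang_ccdf ltNge x0 erlang_tail1.
  by rewrite mulNr.
rewrite ge0_integralZl_EFin//; last 3 first.
- by move=> x _; rewrite lee_fin exponential_pdf_ge0// ltW.
- exact: mpdf.
- by rewrite invr_ge0 ltW.
rewrite -integral_itv_obnd_cbnd; last exact: mpdf.
rewrite -/(exponential_prob rate `]0, +oo[) exponential_prob_itvoy//.
rewrite /erlang_ccdf ltxx erlang_tail1.
by rewrite mulr0 oppr0 expR0 mule1.
Qed.

Lemma integrable_exponential (X : {RV P >-> R}) :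
  is_exponential rate X -> P.-integrable setT (EFin \o X).
Proof.
move=> expX; apply: ae_ge0_integrable; last first.
  by rewrite expectation_exponential// ltry.
by move=> x x0; rewrite ccdf_exponential// erlang_ccdf_lt0.
Qed.

Lemma expectation_sum_exponential (I : Type) (X : I -> {RV P >-> R})
    (s : seq I) :
  (forall i, is_exponential rate (X i)) ->
  'E_P[mfun_sum X s]%E = ((size s)%:R / rate)%:E.
Proof.
(* Integrability is carried through the induction because additivity of the expectation requires
   it. *)
move=> expX; suff [] : ((mfun_sum X s : T -> R) \in Lfun P 1) /\
  'E_P[mfun_sum X s]%E = ((size s)%:R / rate)%:E by [].
elim: s => [|i s [IHL IHE]].
  rewrite /mfun_sum big_nil mul0r; split; last exact: expectation_cst.
  exact: Lfun_cst.
have XL : (X i : T -> R) \in Lfun P 1.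
  by apply/Lfun1_integrable; exact: integrable_exponential.
have -> : (mfun_sum X (i :: s) : T -> R) = (X i : T -> R) \+ mfun_sum X s.
  by apply/funext => w; rewrite /mfun_sum big_cons.
split; first exact: rpredD.
rewrite expectationD// IHE expectation_exponential// -EFinD.
by congr EFin; rewrite /= -natr1; field; rewrite gt_eqF.
Qed.

End laws.

(** * Tail and mean of an Erlang variable *)

Section erlang.
Context d (T : measurableType d) (R : realType) (P : probability T R).
Variables (kappa : nat) (rate : R).
Hypothesis rate_gt0 : 0 < rate.
Variable X : {RV P >-> R}.
Hypothesis erlangX : is_erlang kappa rate X.

(** The exponentials behind [X] may live on another probability space, so what is transferred to [X]
    must depend on the law alone; [Z] is their sum. *)
Let ccdf_erlang_sum : exists (d' : measure_display) (T' : measurableType d')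
  (P' : probability T' R) (Z : {RV P' >-> R}),
  [/\ forall x, ccdf X x = ccdf Z x,
      forall x, ccdf Z x = (erlang_ccdf kappa rate x)%:E &
      'E_P'[Z]%E = (kappa%:R / rate)%:E].
Proof.
have [d' [T' [P' [Y [indepY expY lawX]]]]] := erlangX.
have sizeE : size (index_enum 'I_kappa) = kappa.
  by rewrite -[RHS]card_ord cardT enumT.
exists d', T', P', (mfun_sum Y (index_enum _)); split=> [x|x|].
- rewrite /ccdf lawX//; rewrite /distribution /pushforward; congr (P' _).
  by apply/seteqP; split=> w /=; rewrite mfun_sumE.
- by rewrite (ccdf_sum_exponential rate_gt0 indepY) ?sizeE ?index_enum_uniq.
- by rewrite (expectation_sum_exponential rate_gt0)// sizeE.
Qed.

Lemma ccdf_erlang x : ccdf X x = (erlang_ccdf kappa rate x)%:E.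
Proof. by have [d' [T' [P' [Z [-> ->]]]]] := ccdf_erlang_sum. Qed.

Let ccdf_erlang_lt0 x : x < 0 -> ccdf X x = 1%E.
Proof. by move=> x0; rewrite ccdf_erlang /erlang_ccdf x0. Qed.

(** [X] and [Z] have equal tails, hence equal means by the tail formula, and the mean of [Z] is
    known by additivity. The Erlang tail itself is never integrated. *)
Lemma expectation_erlang : 'E_P[X]%E = (kappa%:R / rate)%:E.
Proof.
have [d' [T' [P' [Z [XZ ZE <-]]]]] := ccdf_erlang_sum.
rewrite ae_ge0_expectation_ccdf// ae_ge0_expectation_ccdf.
  exact: eq_integral.
by move=> x x0; rewrite -XZ ccdf_erlang_lt0.
Qed.

Lemma integrable_erlang : P.-integrable setT (EFin \o X).
Proof.
by apply: ae_ge0_integrable => //; rewrite expectation_erlang ltry.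
Qed.

End erlang.

(** * Maxima of finitely many random variables *)

Section maximum.
Context d (T : measurableType d) (R : realType) (P : probability T R).

Lemma measurable_bigmaxr (I : Type) (f : I -> T -> R) (s : seq I) :
  (forall i, measurable_fun setT (f i)) ->
  measurable_fun setT (fun w => \big[Num.max/0]_(i <- s) f i w).
Proof.
move=> mf; elim: s => [|i s IH].
  by under eq_fun do rewrite big_nil; exact: measurable_cst.
by under eq_fun do rewrite big_cons; exact: measurable_maxr.
Qed.

(** The maximum is at most [r] exactly when every variable is; since it is seeded with 0, this uses
    [0 <= r]. Injectivity of [g] makes the list of indices duplicate-free, as the product rule
    demands. *)
Lemma cdf_bigmaxr (I : eqType) (l : nat) (J : set I) (X : I -> {RV P >-> R})
    (g : 'I_l -> I) (M : {RV P >-> R}) (r : R) :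
  mutually_independent J X -> injective g -> (forall i, J (g i)) ->
  (forall w, M w = \big[Num.max/0]_(i < l) X (g i) w) -> 0 <= r ->
  cdf M r = (\prod_(i < l) cdf (X (g i)) r)%E.
Proof.
move=> indepX injg Jg ME r0.
transitivity (P (\bigcap_(j in [set` map g (index_enum 'I_l)])
    (X j @^-1` `]-oo, r]))).
  rewrite /cdf /distribution /pushforward; congr (P _).
  apply/seteqP; split=> w /=; rewrite in_itv/= ME.
    move=> /bigmax_leP[_ h] j /= /mapP[i _ ->].
    by rewrite in_itv/= h.
  move=> h; apply/bigmax_leP; split=> // i _.
  have := h (g i); rewrite /= in_itv/=; apply.
  by apply/mapP; exists i; rewrite ?mem_index_enum.
rewrite indepX ?big_map//.
- by rewrite map_inj_uniq// index_enum_uniq.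
- by move=> j /mapP[i _ ->].
Qed.

End maximum.

(** By induction, each binary maximum being dominated by the sum of the two absolute values. *)
Lemma integrable_bigmaxr d (T : measurableType d) (R : realType)
    (P : probability T R) (I : Type) (f : I -> T -> R) (s : seq I) :
  (forall i, P.-integrable setT (EFin \o f i)) ->
  P.-integrable setT (EFin \o (fun w => \big[Num.max/0]_(i <- s) f i w)).
Proof.
move=> intf.
have mf i : measurable_fun setT (f i).
  by apply/measurable_EFinP; exact: measurable_int (intf i).
elim: s => [|i s IH].
  under [X in _ \o X]eq_fun do rewrite big_nil.
  exact: finite_measure_integrable_cst.
apply: (le_integrable _ _ _
  (integrableD measurableT (integrable_abse (intf i)) (integrable_abse IH))) => //.
  by apply/measurable_EFinP; exact: measurable_bigmaxr.
move=> w _ /=; rewrite big_cons !lee_fin [leRHS]ger0_norm ?addr_ge0//.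
rewrite /Num.max; case: ifP => _; rewrite ?lerDl ?lerDr//.
Qed.

(** * Mean of the job service time *)

Section service_time.
Context d (T : measurableType d) (R : realType) (P : probability T R).
Variables (l kappa : nat) (rate : R) (S : split_merge P l).
Hypothesis rate_gt0 : 0 < rate.
Hypothesis indep_task : mutually_independent
  [set ni : nat * 'I_l | (1 <= ni.1)%N]
  (fun ni : nat * 'I_l => task S ni.1 ni.2).
Hypothesis erlang_task : forall (n : nat) (i : 'I_l), (1 <= n)%N ->
  is_erlang kappa rate (task S n i).
Variable n : nat.
Hypothesis n_gt0 : (1 <= n)%N.

Let job_service_timeEfun : job_service_time S n =
  (fun w => \big[Num.max/0]_(i < l) task S n i w).
Proof. by apply/funext => w; exact: job_service_timeE. Qed.

Lemma integrable_job_service_time :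
  P.-integrable setT (EFin \o job_service_time S n).
Proof.
rewrite job_service_timeEfun; apply: integrable_bigmaxr => i.
by apply: integrable_erlang rate_gt0 _ (erlang_task _ _).
Qed.

Lemma expectation_job_service_time :
  ('E_P[job_service_time S n] = \int[lebesgue_measure]_(x in `[0%R, +oo[)
     (1 - (1 - erlang_tail kappa rate x) ^+ l)%:E)%E.
Proof.
have mM : measurable_fun setT (job_service_time S n).
  by apply/measurable_EFinP; exact: measurable_int integrable_job_service_time.
pose M : {RV P >-> R} := HB.pack (job_service_time S n)
  (isMeasurableFun.Build _ _ _ _ _ mM).
transitivity ('E_P[M])%E => //.
(* Seeded with 0, the maximum is nonnegative everywhere, so the tail formula applies directly. *)
rewrite ge0_expectation_ccdf; last first.
  by move=> w; rewrite /M/= job_service_timeE//; exact: bigmax_ge_id.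
apply: eq_integral => x; rewrite inE/= in_itv/= andbT => x0.
(* The tasks of job [n] sit at the indices [(n, i)] of the independent family, so the tail is 1
   minus a product of [l] equal factors. *)
rewrite ccdf_1_cdf (cdf_bigmaxr (g := fun i => (n, i)) indep_task)//; last 2 first.
- by move=> i j [].
- by move=> w; rewrite /M/= job_service_timeE.
rewrite (eq_bigr (fun=> (1 - erlang_tail kappa rate x)%:E)); last first.
  move=> i _; rewrite cdf_1_ccdf (ccdf_erlang rate_gt0 (erlang_task _ _))//.
  by rewrite /erlang_ccdf ltNge x0.
by rewrite prodEFin prodr_const card_ord.
Qed.

(** Each task is pointwise at most the maximum. The bound serves to show that the mean job service
    time is positive. *)
Lemma le_expectation_task_job (i : 'I_l) :
  ('E_P[task S n i] <= 'E_P[job_service_time S n])%E.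
Proof.
rewrite unlock; apply: le_integral => //.
- by apply: integrable_erlang rate_gt0 _ (erlang_task _ _).
- exact: integrable_job_service_time.
- by move=> w _; rewrite lee_fin job_service_timeE//; exact: le_bigmax.
Qed.

End service_time.

(** * Stability as a bound on the utilization *)

Theorem mainTheorem3 (d : measure_display) (T : measurableType d)
    (R : realType) (P : probability T R) (l kappa : nat) (lambda mu : R)
    (S : split_merge P l) :
  (1 <= l)%N -> (1 <= kappa)%N -> 0 < lambda -> 0 < mu ->
  mutually_independent [set ni : nat * 'I_l | (1 <= ni.1)%N]
    (fun ni : nat * 'I_l => task S ni.1 ni.2) ->
  (forall (n : nat) (i : 'I_l), (1 <= n)%N -> is_erlang kappa mu (task S n i)) ->
  mutually_independent [set n : nat | (1 <= n)%N] (interarrival S) ->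
  (forall n : nat, (1 <= n)%N -> is_exponential lambda (interarrival S n)) ->
  forall (n : nat) (i : 'I_l), (1 <= n)%N ->
  let EQ := fine ('E_P[task S n i])%E in
  let EDelta := fine ('E_P[job_service_time S n])%E in
  let rho := lambda * EQ in
  [/\ P.-integrable setT (EFin \o task S n i)
        /\ P.-integrable setT (EFin \o job_service_time S n),
      rho = lambda * kappa%:R / mu,
      0 < EDelta
        /\ ('E_P[job_service_time S n])%E =
           (\int[lebesgue_measure]_(x in `[0%R, +oo[)
              (1 - (1 - expR (- (mu * x)) *
                      \sum_(0 <= j < kappa) (mu * x) ^+ j / j`!%:R) ^+ l)%:E)%E,
      stable S <-> lambda * EDelta < 1 &
      (lambda * EDelta < 1 <-> rho < EQ / EDelta)
        /\ EQ / EDelta = kappa%:R / (mu * EDelta)].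
Proof.
move=> l_gt0 kappa_gt0 lambda_gt0 mu_gt0 indep_task erlang_task indep_arr exp_arr.
move=> n i n_gt0 EQ EDelta rho.
have intD m : (1 <= m)%N -> P.-integrable setT (EFin \o job_service_time S m).
  by move=> m_gt0; exact: integrable_job_service_time mu_gt0 erlang_task _ m_gt0.
(* [EDelta] is defined from job [n], but the integral does not depend on the job, so it is the mean
   for every [m]; [stable] ranges over all jobs. *)
have ED m : (1 <= m)%N -> ('E_P[job_service_time S m] = EDelta%:E)%E.
  move=> m_gt0; rewrite /EDelta fineK; last first.
    by rewrite expectation_fin_num//; apply/Lfun1_integrable; exact: intD.
  by rewrite !(expectation_job_service_time mu_gt0 indep_task erlang_task).
have EQE : ('E_P[task S n i] = (kappa%:R / mu)%:E)%E.
  by apply: expectation_erlang => //; exact: erlang_task.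
have EQ_val : EQ = kappa%:R / mu by rewrite /EQ EQE.
have EQ_gt0 : 0 < EQ by rewrite EQ_val divr_gt0// ltr0n.
have EDelta_gt0 : 0 < EDelta.
  have := le_expectation_task_job mu_gt0 erlang_task n_gt0 i.
  by rewrite ED// EQE -EQ_val lee_fin; exact: lt_le_trans.
split.
- split; last exact: intD.
  by apply: integrable_erlang mu_gt0 _ (erlang_task _ _ _).
- by rewrite /rho EQ_val mulrA.
- split=> //.
  by rewrite (expectation_job_service_time mu_gt0 indep_task erlang_task).
(* Every instance of [stable] is the same inequality [EDelta < lambda^-1], so the instance at [n]
   yields all the others. *)
- have stableE m : (1 <= m)%N ->
      ('E_P[job_service_time S m] < 'E_P[interarrival S m])%E =
      (lambda * EDelta < 1).
    move=> m_gt0; rewrite ED// (expectation_exponential lambda_gt0 (exp_arr _ _))//.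
    by rewrite lte_fin -[_^-1]mul1r ltr_pdivlMr// mulrC.
  split=> [/(_ n n_gt0)|stab m m_gt0]; first by rewrite stableE.
  by rewrite stableE.
- split; last by rewrite EQ_val invfM mulrA.
  (* Multiply by [EDelta > 0], then cancel [EQ > 0]. *)
  suff -> : (rho < EQ / EDelta) = (lambda * EDelta < 1) by [].
  by rewrite ltr_pdivlMr// /rho mulrAC -[ltRHS]mul1r ltr_pM2r.
Qed.
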